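(* Let $F$ be a field of characteristic zero, $G$ a finite abelian group, and let $M_n(F)$ carry an elementary $G$-grading induced by $(g_1,\dots,g_n)\in G^n$ which is $G$-regular. Let $A$ be a $G$-graded PI-algebra with $T_G(A)=T_G(M_n(F))$. Then for any positive integers $d_1,\dots,d_m$, \[T_G(UT(d_1,\dots,d_m;A))=T_G(M_{d_1}(A))\,T_G(M_{d_2}(A))\cdots T_G(M_{d_m}(A)).\]
   Context: All algebras are associative and unitary. The elementary grading of $M_n(F)$ induced by $(g_1,\dots,g_n)$ gives the matrix unit $e_{ij}$ degree $g_jg_i^{-1}$. For $G$ abelian, such a grading is called $G$-regular when the map $i\mapsto g_i$ from $\{1,\dots,n\}$ to $G$ is surjective and all its fibers have the same cardinality. $F\langle X\rangle$ is the free associative algebra on $X=\bigcup_{g\in G}X^g$ (disjoint countable sets of variables of degree $g$), naturally $G$-graded; for a $G$-graded algebra $A$, $T_G(A)$ is the ideal of graded polynomial identities of $A$ (graded polynomials vanishing under all degree-preserving substitutions of homogeneous elements of $A$). The product of $T_G$-ideals is the usual product of ideals in $F\langle X\rangle$. $UT(d_1,\dots,d_m;A)$ is the algebra of block upper-triangular matrices in $M_{d_1+\cdots+d_m}(A)$ with $(r,s)$ block ($r\le s$) arbitrary $d_r\times d_s$ over $A$ and zero blocks below the diagonal; it and each $M_d(A)$ are graded by letting the degree-$g$ component consist of matrices all of whose entries lie in $A^g$. *)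

(* Defs.v *)
From HB Require Import structures.
From mathcomp Require Import all_boot all_order all_algebra all_fingroup.
Set Implicit Arguments. Unset Strict Implicit. Unset Printing Implicit Defensive.
Import GRing.Theory.
Local Open Scope ring_scope.

(* Noncommutative polynomials over F in variables of type V, represented as
   finite lists of monomials (coefficient, word).  Two lists represent the same
   element of the free algebra F<V> iff they have the same coefficient function
   [ncoef].  Variables of the graded free algebra F<X> are pairs (g, k) : G * nat,
   the k-th variable of degree g. *)
Section FreeAlg.
Variables (F : fieldType) (V : eqType).

Definition ncpoly := seq (F * seq V).

Definition ncoef (p : ncpoly) (w : seq V) : F :=
  \sum_(m <- p | m.2 == w) m.1.

Definition nceq (p q : ncpoly) : Prop := forall w, ncoef p w = ncoef q w.

Definition ncmul (p q : ncpoly) : ncpoly :=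
  [seq (a.1 * b.1, a.2 ++ b.2) | a <- p, b <- q].

(* evaluation in a ring R whose F-algebra structure is given by the
   (central) scalar map sc : F -> R *)
Definition nceval (R : pzRingType) (sc : F -> R) (phi : V -> R) (p : ncpoly) : R :=
  \sum_(m <- p) sc m.1 * \prod_(v <- m.2) phi v.

Definition ideal_mul (I J : ncpoly -> Prop) : ncpoly -> Prop :=
  fun p => exists s : seq (ncpoly * ncpoly),
    (forall x, x \in s -> I x.1 /\ J x.2) /\
    nceq p (flatten [seq ncmul x.1 x.2 | x <- s]).

Fixpoint ideal_prod (Is : seq (ncpoly -> Prop)) : ncpoly -> Prop :=
  match Is with
  | [::] => fun _ => True
  | [:: J] => J
  | J :: Is' => ideal_mul J (ideal_prod Is')
  end.
End FreeAlg.

Section Graded.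
Variables (F : fieldType) (gT : finGroupType).

Definition gpoly := ncpoly F (gT * nat)%type.

Definition TG (R : pzRingType) (sc : F -> R) (hom : gT -> R -> Prop) : gpoly -> Prop :=
  fun p => forall phi : gT * nat -> R, (forall v, hom v.1 (phi v)) ->
    nceval sc phi p = 0.

Definition is_grading (A : algType F) (Ag : gT -> A -> Prop) : Prop :=
  [/\ (forall g, Ag g 0),
      (forall g a b, Ag g a -> Ag g b -> Ag g (a + b)),
      (forall g (c : F) a, Ag g a -> Ag g (c *: a)) &
      [/\ (forall g h a b, Ag g a -> Ag h b -> Ag (g * h)%g (a * b)),
      (forall a, exists comp : gT -> A,
          (forall g, Ag g (comp g)) /\ a = \sum_(g : gT) comp g) &
      (forall comp : gT -> A, (forall g, Ag g (comp g)) ->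
          \sum_(g : gT) comp g = 0 -> forall g, comp g = 0)]].

Definition is_PI (A : algType F) : Prop :=
  exists p : ncpoly F nat, (exists w, ncoef p w != 0) /\
    forall phi : nat -> A, nceval (fun c => c%:A) phi p = 0.

(* elementary grading of M_n(F) induced by gs : e_ij has degree g_j g_i^-1 *)
Definition elem_hom n (gs : 'I_n -> gT) (g : gT) (M : 'M[F]_n) : Prop :=
  forall i j, M i j != 0 -> (gs j * (gs i)^-1)%g = g.

Definition G_regular n (gs : 'I_n -> gT) : Prop :=
  (forall g, exists i, gs i = g) /\
  (forall g h, #|[set i | gs i == g]| = #|[set i | gs i == h]|).

Definition TG_Mn n (gs : 'I_n -> gT) : gpoly -> Prop :=
  TG (R := 'M[F]_n) (fun c => c%:M) (elem_hom gs).

Definition mx_hom (A : algType F) (Ag : gT -> A -> Prop) d (g : gT) (M : 'M[A]_d) : Prop :=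
  forall i j, Ag g (M i j).

Definition TG_Md (A : algType F) (Ag : gT -> A -> Prop) d : gpoly -> Prop :=
  TG (R := 'M[A]_d) (fun c => (c%:A)%:M) (mx_hom Ag (d := d)).

Fixpoint blk (ds : seq nat) (i : nat) : nat :=
  match ds with
  | [::] => 0
  | d :: ds' => if (i < d)%N then 0 else (blk ds' (i - d)).+1
  end.

(* UT(d_1,...,d_m; A) inside M_{d_1+...+d_m}(A): homogeneous elements of degree g
   are the block upper triangular matrices all of whose entries lie in A_g *)
Definition ut_hom (A : algType F) (Ag : gT -> A -> Prop) (ds : seq nat) (g : gT)
    (M : 'M[A]_(sumn ds)) : Prop :=
  (forall i j : 'I_(sumn ds), (blk ds j < blk ds i)%N -> M i j = 0) /\
  (forall i j, Ag g (M i j)).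

Arguments ut_hom {A} Ag ds.

Definition TG_UT (A : algType F) (Ag : gT -> A -> Prop) (ds : seq nat) : gpoly -> Prop :=
  TG (R := 'M[A]_(sumn ds)) (fun c => (c%:A)%:M) (ut_hom Ag ds).
End Graded.

(* Main.v *)
Require Import Defs.
From HB Require Import structures.
From mathcomp Require Import all_boot all_order all_algebra all_fingroup.
From mathcomp Require Import boolp.

(** The entries of a polynomial evaluated at generic matrices are again
    polynomials, so T_G(UT(d_1, ..., d_m; A)) depends only on T_G(A), and A may
    be replaced by M_n(F); the algebra then becomes a block triangular matrix
    algebra over F with an elementary grading, and one splits off the first
    block.  For ideals I1, I2 of R = F<X>, a polynomial p in I1 and I2 lies in
    I1 I2 as soon as, for every variable x, the sum of c u (x) v over the
    terms c u x v of p vanishes in R/I1 (x) R/I2 (Lewin).  An identity of the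
    two-block algebra gives this vanishing when tested on matrix units of degree
    deg x in the off-diagonal block; G-regularity of the first block provides
    graded automorphisms that move the row index of such a unit to any row. *)

Set Implicit Arguments. Unset Strict Implicit. Unset Printing Implicit Defensive.
Import GRing.Theory.
Local Open Scope ring_scope.

(** * Linear functionals on the free algebra, determined by their values on words *)

Section LinearForms.
Variables (F : fieldType) (V : eqType).
Implicit Types (p q : ncpoly F V) (h : seq V -> F).

Definition lin p h : F := \sum_(m <- p) m.1 * h m.2.

Lemma lin_nil h : lin [::] h = 0. Proof. exact: big_nil. Qed.

Lemma lin_cons m p h : lin (m :: p) h = m.1 * h m.2 + lin p h.
Proof. exact: big_cons. Qed.

Lemma lin_cat p q h : lin (p ++ q) h = lin p h + lin q h.
Proof. exact: big_cat. Qed.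

Lemma lin_map (T : Type) (s : seq T) (f : T -> F * seq V) h :
  lin [seq f t | t <- s] h = \sum_(t <- s) (f t).1 * h (f t).2.
Proof. exact: big_map. Qed.

Lemma lin_flatten (T : Type) (s : seq T) (f : T -> ncpoly F V) h :
  lin (flatten [seq f t | t <- s]) h = \sum_(t <- s) lin (f t) h.
Proof. by rewrite /lin big_flatten big_map. Qed.

Definition scale (c : F) p : ncpoly F V := [seq (c * m.1, m.2) | m <- p].

Lemma lin_scale c p h : lin (scale c p) h = c * lin p h.
Proof. by rewrite lin_map /lin mulr_sumr; apply: eq_bigr => m _; rewrite mulrA. Qed.

Lemma eq_lin p h1 h2 : h1 =1 h2 -> lin p h1 = lin p h2.
Proof. by move=> e; apply: eq_bigr => m _; rewrite e. Qed.

Lemma lin_sub p h1 h2 : lin p (fun w => h1 w - h2 w) = lin p h1 - lin p h2.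
Proof. by rewrite /lin -sumrB; apply: eq_bigr => m _; rewrite mulrBr. Qed.

Lemma lin_mull p h c : lin p (fun w => c * h w) = c * lin p h.
Proof. by rewrite /lin mulr_sumr; apply: eq_bigr => m _; rewrite mulrCA. Qed.

Lemma lin_sum (T : Type) (s : seq T) p (h : T -> seq V -> F) :
  lin p (fun w => \sum_(t <- s) h t w) = \sum_(t <- s) lin p (h t).
Proof.
rewrite /lin exchange_big; apply: eq_bigr => m _ /=; exact: mulr_sumr.
Qed.

Lemma ncoef_lin p w : ncoef p w = lin p (fun u => (u == w)%:R).
Proof.
rewrite /ncoef /lin big_mkcond; apply: eq_bigr => m _.
by case: eqP => _; rewrite ?mulr1 ?mulr0.
Qed.

Lemma lin_ncoef (s : seq (seq V)) p h :
    uniq s -> {subset [seq m.2 | m <- p] <= s} ->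
  lin p h = \sum_(w <- s) ncoef p w * h w.
Proof.
move=> us; elim: p => [|m p IH] sub.
  by rewrite lin_nil big1 // => w _; rewrite /ncoef big_nil mul0r.
rewrite lin_cons IH; last by move=> w wp; apply: sub; rewrite inE wp orbT.
have ms : m.2 \in s by apply: sub; rewrite inE eqxx.
have -> : m.1 * h m.2 = \sum_(w <- s) m.1 * (m.2 == w)%:R * h w.
  rewrite (bigD1_seq m.2) //= eqxx mulr1 big1 ?addr0 // => w.
  by rewrite eq_sym => /negbTE ->; rewrite mulr0 mul0r.
rewrite -big_split; apply: eq_bigr => w _ /=.
by rewrite !ncoef_lin lin_cons -mulrDl.
Qed.

Lemma nceq_lin p q : nceq p q <-> forall h, lin p h = lin q h.
Proof.
split=> [e h|e w]; last by rewrite !ncoef_lin e.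
pose s := undup ([seq m.2 | m <- p] ++ [seq m.2 | m <- q]).
rewrite !(@lin_ncoef s) ?undup_uniq //.
- by apply: eq_bigr => w _; rewrite e.
- by move=> w wq; rewrite mem_undup mem_cat wq orbT.
- by move=> w wp; rewrite mem_undup mem_cat wp.
Qed.

Lemma lin_ncmul p q h :
  lin (ncmul p q) h = lin p (fun u => lin q (fun v => h (u ++ v))).
Proof.
rewrite /lin /ncmul big_allpairs_dep; apply: eq_bigr => a _.
by rewrite mulr_sumr; apply: eq_bigr => b _ /=; rewrite mulrA.
Qed.

(** T-ideals enter the proof as common kernels of functionals, so congruences are tested one
    functional at a time. *)
Definition annih (L : (seq V -> F) -> Prop) p := forall h, L h -> lin p h = 0.

Fixpoint splits (w : seq V) : seq (seq V * V * seq V) :=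
  if w is y :: w' then
    ([::], y, w') :: [seq (y :: t.1.1, t.1.2, t.2) | t <- splits w']
  else [::].

End LinearForms.

(** * Normal forms modulo a subspace, and Lewin's criterion for products of ideals *)

Section Lewin.
Variables (F : fieldType) (V : countType).
Implicit Types (p q : ncpoly F V) (h : seq V -> F) (L : (seq V -> F) -> Prop).

(** [pickle] well-orders the words for a Gaussian elimination modulo [annih L]; the irreducible
    words turn out to give a basis of the quotient. *)
Definition reducible L (w : seq V) :=
  exists q, (forall m, m \in q -> pickle m.2 < pickle w)%N /\
            forall h, L h -> lin q h = h w.

Lemma irreducible_span L w :
  exists q, (forall m, m \in q -> ~ reducible L m.2) /\
            forall h, L h -> lin q h = h w.
Proof.
elim/ltn_ind: {w}(pickle w) {-2}w (erefl (pickle w)) => k IH w wk.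
have [[q0 [sm e0]]|nr] := EM (reducible L w); last first.
  exists [:: (1, w)]; split=> [m|h _]; first by rewrite inE => /eqP ->.
  by rewrite lin_cons lin_nil mul1r addr0.
have [q [q1 q2]] : exists q, (forall m, m \in q -> ~ reducible L m.2) /\
    forall h, L h -> lin q h = lin q0 h.
  elim: q0 sm {e0} => [|m q0 IHq] sm; first by exists [::].
  have [|q [q1 q2]] := IHq; first by move=> a aq; apply: sm; rewrite inE aq orbT.
  have [|r [r1 r2]] := IH (pickle m.2) _ m.2 erefl.
    by rewrite -wk sm // inE eqxx.
  exists (scale m.1 r ++ q); split=> [a|h Lh].
    rewrite mem_cat => /orP[/mapP[b br ->]|]; [exact: (r1 b)|exact: q1].
  by rewrite lin_cat lin_scale r2 // q2 // lin_cons.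
by exists q; split=> // h Lh; rewrite q2 // e0.
Qed.

(** The word of largest code has coefficient zero, since solving the relation for it would make it
    reducible; it is dropped, and induction on a bound for the codes concludes. *)
Lemma irreducible_free L q :
    (forall m, m \in q -> ~ reducible L m.2) -> annih L q ->
  forall h, lin q h = 0.
Proof.
move=> irr Lq h.
have [N] : exists N, forall m, m \in q -> (pickle m.2 < N)%N.
  exists (\max_(m <- q) pickle m.2).+1 => m mq.
  by rewrite ltnS (leq_bigmax_seq (F := fun m => pickle m.2)).
elim: N q irr Lq => [|N IH] q irr Lq bd.
  case: q bd {irr Lq} => [|m q] bd; first exact: lin_nil.
  by have := bd m (mem_head _ _).
have [[m0 [m0q em0]]|no] := EM (exists m, m \in q /\ pickle m.2 = N); last first.
  apply: IH => // m mq; move: (bd m mq); rewrite ltnS leq_eqVlt => /orP[/eqP e|//].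
  by case: no; exists m.
pose w0 := m0.2.
pose q' := [seq m <- q | m.2 != w0].
have qE g : lin q g = ncoef q w0 * g w0 + lin q' g.
  rewrite /lin big_filter (bigID (fun m => m.2 == w0)) /=; congr (_ + _).
  by rewrite /ncoef mulr_suml; apply: eq_bigr => m /eqP ->.
have bd' m : m \in q' -> (pickle m.2 < N)%N.
  rewrite mem_filter => /andP[ne mq]; move: (bd m mq).
  rewrite ltnS leq_eqVlt => /orP[/eqP e|//].
  by case/eqP: ne; apply: (pcan_inj (@pickleK _)); rewrite e.
have c0 : ncoef q w0 = 0.
  apply/eqP/negPn/negP => c; case: (irr m0 m0q).
  exists (scale (- (ncoef q w0)^-1) q'); split=> [m|g Lg].
    by case/mapP=> a aq' -> /=; rewrite em0 bd'.
  have := Lq g Lg; rewrite qE lin_scale => /eqP; rewrite addr_eq0 => /eqP e.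
  by rewrite mulNr -mulrN -e mulrA mulVf // mul1r.
rewrite qE c0 mul0r add0r; apply: IH => //.
  by move=> m; rewrite mem_filter => /andP[_]; exact: irr.
by move=> g Lg; have := Lq g Lg; rewrite qE c0 mul0r add0r.
Qed.

(* [P] is a linear section of the quotient map onto F<V> / annih L. *)
Lemma normal_form L :
  exists P : seq V -> ncpoly F V,
    (forall w h, L h -> lin (P w) h = h w) /\
    (forall q, annih L q -> forall h, lin q (fun w => lin (P w) h) = 0).
Proof.
have [P PP] := choice (irreducible_span L).
exists P; split=> [w h Lh|q Lq h]; first by have [_ ->] := PP w.
(* Replacing each word of [q] by its normal form gives a combination of irreducible words that is
   still in [annih L], hence zero. *)
have E g : lin (flatten [seq scale m.1 (P m.2) | m <- q]) g =
           lin q (fun w => lin (P w) g).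
  by rewrite lin_flatten; apply: eq_bigr => m _; rewrite lin_scale.
rewrite -E; apply: (@irreducible_free L) => [m|g Lg].
  case/flattenP=> _ /mapP[a aq ->] /mapP[b bP ->] /=.
  by have [+ _] := PP a.2; apply.
by rewrite E (eq_lin _ (h2 := g)) ?Lq // => w; have [_ ->] := PP w.
Qed.

(* With [P] the normal form modulo [annih L2], telescoping over the splittings
   w = u x v gives
     p = p (1 - P 1) + P p + \sum_(x, b) q_(x, b) (x b - P (x b)),
   where q_(x, b) is the sum of c * ncoef (P v) b * u over the terms c u x v
   of p.  The hypothesis on splittings puts q_(x, b) in [annih L1]. *)
Lemma lewin L1 L2 p :
    (forall q x, annih L2 q -> annih L2 [seq (m.1, x :: m.2) | m <- q]) ->
    annih L1 p -> annih L2 p ->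
    (forall x h1 h2, L1 h1 -> L2 h2 ->
       lin p (fun w => \sum_(t <- splits w | t.1.2 == x) h1 t.1.1 * h2 t.2) = 0) ->
  ideal_mul (annih L1) (annih L2) p.
Proof.
move=> lid p1 p2 ps; have [P [P1 P2]] := normal_form L2.
(* [trm] lists the terms with a marked letter, as [(c, (u, x, v))]; [xs] and [bs] are finite ranges
   for the letters x and for the words of the P v. *)
pose trm := flatten [seq [seq (m.1, t) | t <- splits m.2] | m <- p].
pose xs := undup [seq a.2.1.2 | a <- trm].
pose bs := undup (flatten [seq [seq b.2 | b <- P a.2.2] | a <- trm]).
pose q x b : ncpoly F V :=
  [seq (a.1 * ncoef (P a.2.2) b, a.2.1.1) | a <- trm & a.2.1.2 == x].
pose r x b : ncpoly F V := (1, x :: b) :: scale (-1) (P (x :: b)).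
have rE x b h : lin (r x b) h = h (x :: b) - lin (P (x :: b)) h.
  by rewrite lin_cons lin_scale mul1r mulN1r.
pose e1 : ncpoly F V := (1, [::]) :: scale (-1) (P [::]).
have e1E h : lin e1 h = h [::] - lin (P [::]) h.
  by rewrite lin_cons lin_scale mul1r mulN1r.
have trmE (f : seq V * V * seq V -> F) :
    \sum_(a <- trm) a.1 * f a.2 = lin p (fun w => \sum_(t <- splits w) f t).
  rewrite big_flatten big_map; apply: eq_bigr => m _.
  by rewrite big_map mulr_sumr.
have qL x b : annih L1 (q x b).
  move=> h1 Lh1; pose s : ncpoly F V :=
    [seq (a.1 * h1 a.2.1.1, a.2.2) | a <- trm & a.2.1.2 == x].
  (* The hypothesis on splittings puts [s] in [annih L2], so its normal form vanishes; the
     coefficient of [b] there is the value of [h1] on [q x b]. *)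
  have Ls : annih L2 s.
    move=> h2 Lh2; rewrite -[RHS](ps x h1 h2 Lh1 Lh2).
    rewrite (eq_lin p (h2 := fun w => \sum_(t <- splits w)
      if t.1.2 == x then h1 t.1.1 * h2 t.2 else 0)); last first.
      by move=> w; rewrite big_mkcond.
    rewrite -(trmE (fun t => if t.1.2 == x then h1 t.1.1 * h2 t.2 else 0)).
    rewrite lin_map big_filter big_mkcond; apply: eq_bigr => a _ /=.
    by case: ifP; rewrite ?mulr0 ?mulrA.
  have := P2 s Ls (fun u => (u == b)%:R).
  rewrite !lin_map !big_filter => e; rewrite -[RHS]e.
  by apply: eq_bigr => a _ /=; rewrite ncoef_lin mulrAC.
have rL x b : annih L2 (r x b) by move=> h Lh; rewrite rE P1 ?subrr.
exists ((p, e1) :: [seq (q x b, r x b) | x <- xs, b <- bs]); split.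
  move=> z; rewrite inE => /orP[/eqP ->|].
    by split=> // h Lh /=; rewrite e1E P1 ?subrr.
  by case/allpairsP=> -[x b] [_ _ ->]; split; [exact: qL|exact: rL].
apply/nceq_lin => h.
rewrite /= lin_cat lin_ncmul (eq_lin _ (fun u => e1E _)) lin_sub.
rewrite (lin_flatten _ (fun z => ncmul z.1 z.2)) big_allpairs_dep /=.
(* For one term only its own letter contributes, and the sum over [b] rebuilds P v, leaving c u x P
   v - c u P (x v). *)
have step a : a \in trm ->
    \sum_(x <- xs) \sum_(b <- bs)
      (if a.2.1.2 == x then a.1 * ncoef (P a.2.2) b *
         lin (r x b) (fun v => h (a.2.1.1 ++ v)) else 0) =
    a.1 * (lin (P a.2.2) (fun v => h (a.2.1.1 ++ a.2.1.2 :: v)) -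
           lin (P (a.2.1.2 :: a.2.2)) (fun v => h (a.2.1.1 ++ v))).
  case: a => c [[u y] v] /= atr.
  rewrite (bigD1_seq y) /= ?undup_uniq //; last first.
    by rewrite mem_undup; apply/mapP; exists (c, (u, y, v)).
  rewrite eqxx [X in _ + X]big1 ?addr0; last first.
    by move=> x; rewrite eq_sym => /negbTE ne; rewrite big1 // => b _; rewrite ne.
  under eq_bigr => b _ do rewrite -mulrA.
  rewrite -mulr_sumr -(@lin_ncoef _ _ bs (P v)
    (fun b => lin (r y b) (fun v => h (u ++ v)))) ?undup_uniq //; last first.
    move=> b bP; rewrite mem_undup; apply/flattenP.
    by exists [seq b.2 | b <- P v] => //; apply/mapP; exists (c, (u, y, v)).
  congr (_ * _); rewrite (eq_lin _ (fun b => rE y b _)) lin_sub; congr (_ - _).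
  (* v - P v lies in [annih L2], hence so does y v - y P v, and therefore P (y P v) = P (y v). *)
  pose d : ncpoly F V := (1, v) :: scale (-1) (P v).
  have Ld : annih L2 d.
    by move=> g Lg; rewrite lin_cons lin_scale mul1r mulN1r P1 ?subrr.
  have := P2 _ (lid d y Ld) (fun v => h (u ++ v)).
  rewrite lin_map big_cons /= mul1r.
  rewrite big_map; under eq_bigr => m _ do rewrite /= mulN1r mulNr.
  by rewrite sumrN => /eqP; rewrite subr_eq0 => /eqP ->.
have -> : \sum_(x <- xs) \sum_(b <- bs) lin (ncmul (q x b) (r x b)) h =
    lin p (fun w => lin (P [::]) (fun v => h (w ++ v))).
  transitivity (\sum_(a <- trm)
    a.1 * (lin (P a.2.2) (fun v => h (a.2.1.1 ++ a.2.1.2 :: v)) -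
           lin (P (a.2.1.2 :: a.2.2)) (fun v => h (a.2.1.1 ++ v)))).
    rewrite -(eq_big_seq _ step) [RHS]exchange_big; apply: eq_bigr => x _ /=.
    rewrite [RHS]exchange_big; apply: eq_bigr => b _ /=.
    by rewrite lin_ncmul lin_map big_filter big_mkcond.
  rewrite (trmE (fun t => lin (P t.2) (fun v => h (t.1.1 ++ t.1.2 :: v)) -
           lin (P (t.1.2 :: t.2)) (fun v => h (t.1.1 ++ v)))).
  (* Subtracting P p, which is zero, makes the sum telescope word by word to w P 1 - P w. *)
  rewrite -[RHS]subr0 -[X in _ = _ - X](P2 p p2 h) -lin_sub; apply: eq_lin => w.
  elim: w h {step} => [|y w IH] h; first by rewrite big_nil subrr.
  rewrite big_cons big_map /= (IH (fun v => h (y :: v))) /=.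
  by rewrite addrC addrA subrK.
by rewrite subrK; apply: eq_lin => w; rewrite cats0.
Qed.

End Lewin.

Lemma ideal_prod_cons (F : fieldType) (V : eqType) (J : ncpoly F V -> Prop)
    (Is : seq (ncpoly F V -> Prop)) : (0 < size Is)%N ->
  ideal_prod (J :: Is) = ideal_mul J (ideal_prod Is).
Proof. by case: Is. Qed.

(** * Entries of products of matrices over a finite index type *)

Section MatrixWords.
Variables (R : pzRingType) (V : Type) (I : finType).
Implicit Types (Phi : V -> I -> I -> R).

(* The (i, j) entry of the product of the I x I matrices [Phi v], v in w. *)
Fixpoint mev Phi (w : seq V) (i j : I) : R :=
  if w is v :: w' then \sum_l Phi v i l * mev Phi w' l j else (i == j)%:R.

Lemma mev_cat Phi u v i j :
  mev Phi (u ++ v) i j = \sum_l mev Phi u i l * mev Phi v l j.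
Proof.
elim: u i => [|x u IH] i /=.
  rewrite (bigD1 i) //= eqxx mul1r big1 ?addr0 // => l.
  by rewrite eq_sym => /negbTE ->; rewrite mul0r.
under eq_bigr => l _ do rewrite IH mulr_sumr.
rewrite exchange_big; apply: eq_bigr => k _ /=.
by rewrite mulr_suml; apply: eq_bigr => l _; rewrite mulrA.
Qed.

End MatrixWords.

Lemma mev_reindex (R : pzRingType) (V : Type) (I J : finType) (f : I -> J)
    (Phi : V -> J -> J -> R) w i j : bijective f ->
  mev (fun v i j => Phi v (f i) (f j)) w i j = mev Phi w (f i) (f j).
Proof.
move=> bf; elim: w i => [|v w IH] i /=; first by rewrite (bij_eq bf).
rewrite (reindex f) /=; last exact: onW_bij.
by apply: eq_bigr => l _; rewrite IH.
Qed.

(** * Identities of elementary graded matrix algebras with prescribed support *)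

Section GradedMatrices.
Variables (F : fieldType) (gT : finGroupType).
Notation V := (gT * nat)%type.

Definition graded_fam (I : finType) (deg : I -> gT) (r : rel I)
    (Phi : V -> I -> I -> F) :=
  forall v i j, Phi v i j != 0 -> r i j /\ (deg j * (deg i)^-1)%g = v.1.

(** Reading off one entry of a graded evaluation is a functional on words; this puts the T-ideal in
    the form that [lewin] takes. *)
Definition entry_forms (I : finType) (deg : I -> gT) (r : rel I)
    (h : seq V -> F) :=
  exists Phi i j, graded_fam deg r Phi /\ h = (fun w => mev Phi w i j).

Definition mx_ids (I : finType) (deg : I -> gT) (r : rel I) : gpoly F gT -> Prop :=
  annih (entry_forms deg r).

Lemma mx_idsP (I : finType) (deg : I -> gT) (r : rel I) p :
  mx_ids deg r p <-> forall Phi, graded_fam deg r Phi ->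
    forall i j, lin p (fun w => mev Phi w i j) = 0.
Proof.
split=> [H Phi g i j|H h [Phi [i [j [g ->]]]]]; last exact: H.
by apply: H; exists Phi, i, j.
Qed.

Lemma mx_ids_bij (I J : finType) (dI : I -> gT) (dJ : J -> gT) (rI : rel I)
    (rJ : rel J) (f : I -> J) p :
    bijective f -> (forall i, dJ (f i) = dI i) ->
    (forall i j, rJ (f i) (f j) = rI i j) ->
  mx_ids dI rI p <-> mx_ids dJ rJ p.
Proof.
move=> bf df rf; have [f' fK f'K] := bf; rewrite !mx_idsP; split=> H Phi gPhi i j.
  rewrite -(f'K i) -(f'K j).
  rewrite -(eq_lin _ (fun w => mev_reindex Phi w _ _ bf)).
  by apply: H => v k l /gPhi; rewrite !df rf.
have bf' : bijective f' by exists f.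
rewrite -(fK i) -(fK j) -(eq_lin _ (fun w => mev_reindex Phi w _ _ bf')).
by apply: H => v k l /gPhi; rewrite -!df -rf !f'K.
Qed.

(** Expanding along the first factor leaves a combination of entries of [q]; this supplies the
    left-ideal hypothesis of [lewin]. *)
Lemma mx_ids_lideal (I : finType) (deg : I -> gT) (r : rel I) (q : gpoly F gT) x :
  mx_ids deg r q -> mx_ids deg r [seq (m.1, x :: m.2) | m <- q].
Proof.
rewrite !mx_idsP => H Phi gPhi i j; rewrite lin_map /=.
have := lin_sum (index_enum I) q (fun l w => Phi x i l * mev Phi w l j).
rewrite /lin => ->; apply: big1 => l _.
by have := lin_mull q (fun w => mev Phi w l j) (Phi x i l); rewrite H // mulr0.
Qed.

(** * Two-block triangular algebras and products of ideals *)

Section Block.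
Variables (I1 I2 : finType) (d1 : I1 -> gT) (d2 : I2 -> gT).
Variables (r1 : rel I1) (r2 : rel I2).

Definition block_deg (i : I1 + I2) :=
  match i with inl a => d1 a | inr b => d2 b end.

Definition block_rel (i j : I1 + I2) :=
  match i, j with
  | inl a, inl b => r1 a b
  | inr a, inr b => r2 a b
  | inl _, inr _ => true
  | inr _, inl _ => false
  end.

Let Phi1 (Phi : V -> I1 + I2 -> I1 + I2 -> F) v a b := Phi v (inl a) (inl b).
Let Phi2 (Phi : V -> I1 + I2 -> I1 + I2 -> F) v a b := Phi v (inr a) (inr b).

Lemma graded_fam1 Phi :
  graded_fam block_deg block_rel Phi -> graded_fam d1 r1 (Phi1 Phi).
Proof. by move=> g v i j /g. Qed.

Lemma graded_fam2 Phi :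
  graded_fam block_deg block_rel Phi -> graded_fam d2 r2 (Phi2 Phi).
Proof. by move=> g v i j /g. Qed.

Lemma mev_block21 Phi w b a : graded_fam block_deg block_rel Phi ->
  mev Phi w (inr b) (inl a) = 0.
Proof.
move=> g; elim: w b => [|v w IH] b //=.
rewrite big_sumType /= [X in X + _]big1 ?add0r => [|l _].
  by apply: big1 => l _; rewrite IH mulr0.
have -> : Phi v (inr b) (inl l) = 0 by apply/eqP/negPn/negP => /g[].
by rewrite mul0r.
Qed.

Lemma mev_block11 Phi w a b : graded_fam block_deg block_rel Phi ->
  mev Phi w (inl a) (inl b) = mev (Phi1 Phi) w a b.
Proof.
move=> g; elim: w a => [|v w IH] a //=.
rewrite big_sumType /= [X in _ + X]big1 ?addr0 => [|l _].
  by apply: eq_bigr => l _; rewrite IH.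
by rewrite mev_block21 ?mulr0.
Qed.

Lemma mev_block22 Phi w a b : graded_fam block_deg block_rel Phi ->
  mev Phi w (inr a) (inr b) = mev (Phi2 Phi) w a b.
Proof.
move=> g; elim: w a => [|v w IH] a //=.
rewrite big_sumType /= [X in X + _]big1 ?add0r => [|l _].
  by apply: eq_bigr => l _; rewrite IH.
have -> : Phi v (inr a) (inl l) = 0 by apply/eqP/negPn/negP => /g[].
by rewrite mul0r.
Qed.

(** A path of indices from the first block to the second crosses over exactly once, at the marked
    letter of a splitting. *)
Lemma mev_block12 Phi w i j : graded_fam block_deg block_rel Phi ->
  mev Phi w (inl i) (inr j) =
  \sum_(t <- splits w) \sum_a \sum_b
    mev (Phi1 Phi) t.1.1 i a * Phi t.1.2 (inl a) (inr b) * mev (Phi2 Phi) t.2 b j.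
Proof.
move=> g; elim: w i => [|v w IH] i /=; first by rewrite big_nil.
rewrite big_sumType /= big_cons big_map addrC /=; congr (_ + _).
  rewrite (bigD1 i) //= [X in _ = _ + X]big1 ?addr0.
    by apply: eq_bigr => b _; rewrite eqxx mul1r mev_block22.
  move=> a; rewrite eq_sym => /negbTE ne; apply: big1 => b _.
  by rewrite ne !mul0r.
under eq_bigr => a _ do rewrite IH mulr_sumr.
rewrite exchange_big; apply: eq_bigr => t _ /=.
under eq_bigr => a _ do rewrite mulr_sumr.
rewrite exchange_big; apply: eq_bigr => b _ /=.
under eq_bigr => a _ do rewrite mulr_sumr.
rewrite exchange_big; apply: eq_bigr => c _ /=.
by rewrite !mulr_suml; apply: eq_bigr => a _; rewrite !mulrA.
Qed.

(** For every intermediate index one of the two factors vanishes, by triangularity or by membership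
    in its ideal. *)
Lemma ideal_mul_block (p : gpoly F gT) :
  ideal_mul (mx_ids d1 r1) (mx_ids d2 r2) p -> mx_ids block_deg block_rel p.
Proof.
case=> s [sI /nceq_lin pE]; apply/mx_idsP => Phi g i j.
rewrite pE lin_flatten big_seq; apply: big1 => -[q1 q2] /sI[] /=.
move=> /mx_idsP/(_ _ (graded_fam1 g)) h1 /mx_idsP/(_ _ (graded_fam2 g)) h2.
have -> : lin (ncmul q1 q2) (fun w => mev Phi w i j) =
    \sum_l lin q1 (fun w => mev Phi w i l) * lin q2 (fun w => mev Phi w l j).
  transitivity (\sum_l lin q1 (fun u => lin q2 (fun w => mev Phi w l j) *
      mev Phi u i l)).
    rewrite lin_ncmul -lin_sum; apply: eq_lin => u.
    rewrite (eq_lin _ (fun v => mev_cat Phi u v i j)) lin_sum.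
    by apply: eq_bigr => l _; rewrite lin_mull mulrC.
  by apply: eq_bigr => l _; rewrite lin_mull mulrC.
have z0 q (h : seq V -> F) : (forall w, h w = 0) -> lin q h = 0.
  by move=> e; apply: big1 => m _; rewrite e mulr0.
have z21 b a : lin q1 (fun w => mev Phi w (inr b) (inl a)) = 0.
  by apply: z0 => w; rewrite mev_block21.
have z21' b a : lin q2 (fun w => mev Phi w (inr b) (inl a)) = 0.
  by apply: z0 => w; rewrite mev_block21.
have z11 a b : lin q1 (fun w => mev Phi w (inl a) (inl b)) = 0.
  by rewrite (eq_lin _ (fun w => mev_block11 w a b g)) h1.
have z22 a b : lin q2 (fun w => mev Phi w (inr a) (inr b)) = 0.
  by rewrite (eq_lin _ (fun w => mev_block22 w a b g)) h2.
rewrite big_sumType /=; case: i => i; case: j => j;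
  rewrite [X in X + _]big1 ?[X in _ + X]big1 ?addr0 // => l _;
  by rewrite ?z11 ?z21 ?z22 ?z21' ?mul0r ?mulr0.
Qed.

Hypothesis abG : abelian [set: gT].
(** Relabelling by [f] is conjugation by a permutation matrix; G-regularity will provide it. *)
Hypothesis shift : forall h : gT, exists f : I1 -> I1,
  [/\ bijective f, forall i, d1 (f i) = (h * d1 i)%g &
      forall i j, r1 (f i) (f j) = r1 i j].

Let mulgC (x y : gT) : (x * y = y * x)%g.
Proof. by apply: (centsP abG); rewrite inE. Qed.

(* The matrix unit e_ab of the off-diagonal block has degree x.1 only for
   matching a and b; shifting the degrees of the first block by an element of
   gT, which leaves the degrees of its entries unchanged, reaches the others. *)
Lemma block_ideal_mul (p : gpoly F gT) :
  mx_ids block_deg block_rel p -> ideal_mul (mx_ids d1 r1) (mx_ids d2 r2) p.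
Proof.
move/mx_idsP => H.
pose blk12 (P1 : V -> I1 -> I1 -> F) (P2 : V -> I2 -> I2 -> F) T v i j :=
  match i, j with
  | inl a, inl b => P1 v a b
  | inr a, inr b => P2 v a b
  | inl a, inr b => T v a b
  | inr _, inl _ => 0
  end.
have gblk P1 P2 T : graded_fam d1 r1 P1 -> graded_fam d2 r2 P2 ->
    (forall v a b, T v a b != 0 -> (d2 b * (d1 a)^-1)%g = v.1) ->
    graded_fam block_deg block_rel (blk12 P1 P2 T).
  move=> g1 g2 gt v [a|a] [b|b] /=; [exact: g1|by move/gt|by rewrite eqxx|exact: g2].
have g0 (I : finType) (d : I -> gT) r : graded_fam d r (fun _ _ _ => 0).
  by move=> v i j; rewrite eqxx.
have gT0 (v : V) (a : I1) (b : I2) : (0 : F) != 0 -> (d2 b * (d1 a)^-1)%g = v.1.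
  by rewrite eqxx.
apply: lewin.
- by move=> q x; apply: mx_ids_lideal.
- apply/mx_idsP => P1 g1 i j; have g := gblk P1 _ (fun _ _ _ => 0) g1 (g0 _ d2 r2) gT0.
  by rewrite -[RHS](H _ g (inl i) (inl j)); apply: eq_lin => w; rewrite mev_block11.
- apply/mx_idsP => P2 g2 i j; have g := gblk _ P2 (fun _ _ _ => 0) (g0 _ d1 r1) g2 gT0.
  by rewrite -[RHS](H _ g (inr i) (inr j)); apply: eq_lin => w; rewrite mev_block22.
move=> x _ _ [P1 [i0 [a0 [g1 ->]]]] [P2 [b [j [g2 ->]]]].
(* The shift is chosen so that the preimage of [a0] under [f] has degree [x.1^-1 * d2 b]; its matrix
   unit with column [b] then has degree [x.1]. *)
have [f [bf df rf]] := shift (d1 a0 * (x.1^-1 * d2 b)^-1)%g.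
have [f' fK f'K] := bf.
pose Q1 v i j := P1 v (f i) (f j).
have gQ : graded_fam d1 r1 Q1.
  move=> v i k /g1; rewrite rf !df => -[-> <-]; split=> //.
  (* The shift cancels from the quotient of degrees because the group is abelian. *)
  set h := (X in (X * d1 k)%g).
  by rewrite (mulgC h) (mulgC h) invMg mulgA mulgK.
pose T (v : V) a c : F := ((v == x) && (a == f' a0) && (c == b))%:R.
have gTT v a c : T v a c != 0 -> (d2 c * (d1 a)^-1)%g = v.1.
  have [/andP[/andP[/eqP -> /eqP ->] /eqP ->] _|nT] :=
    boolP ((v == x) && (a == f' a0) && (c == b)); last first.
    by rewrite /T (negbTE nT) eqxx.
  have e := df (f' a0); rewrite f'K in e.
  have -> : d1 (f' a0) = (x.1^-1 * d2 b)%g.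
    apply: (mulgI (d1 a0 * (x.1^-1 * d2 b)^-1)%g).
    by rewrite -e -mulgA mulVg mulg1.
  by rewrite invMg invgK mulgA mulgV mul1g.
have g := gblk _ _ _ gQ g2 gTT.
(* In this entry only the crossing from [f' a0] to [b] at the letter [x] survives, and undoing [f]
   on the left factor gives back the [(i0, a0)] entry for [P1]. *)
rewrite -[RHS](H _ g (inl (f' i0)) (inr j)); apply: eq_lin => w.
rewrite mev_block12 // big_mkcond; apply: eq_bigr => -[[u y] v] _ /=.
rewrite (bigD1 (f' a0)) //= [X in _ = _ + X]big1 ?addr0; last first.
  move=> a /negbTE ne; apply: big1 => c _.
  by rewrite /T ne andbF mulr0 mul0r.
rewrite (bigD1 b) //= [X in _ = _ + X]big1 ?addr0; last first.
  by move=> c /negbTE ne; rewrite /T ne andbF mulr0 mul0r.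
rewrite /T !eqxx !andbT; case: ifP => _; last by rewrite mulr0 mul0r.
by rewrite mulr1 /Phi1 /= (mev_reindex P1 u _ _ bf) !f'K.
Qed.

End Block.

(** * Change of the coefficient algebra through generic matrices *)

Section Transfer.
Variables (N : nat) (r : rel 'I_N).

(** Coding the triple as one number keeps the generic entries distinct while each has the degree of
    its matrix. *)
Definition entry_var (v : V) (i l : 'I_N) : V := (v.1, pickle (v.2, i, l)).

Fixpoint entry_words (w : seq V) (i j : 'I_N) : seq (seq V) :=
  if w is v :: w' then
    flatten [seq [seq entry_var v i l :: t | t <- entry_words w' l j]
            | l <- [seq l <- index_enum 'I_N | r i l]]
  else if i == j then [:: [::]] else [::].

(* The (i, j) entry of p at generic matrices with support in [r]. *)
Definition entry_poly (p : gpoly F gT) i j : gpoly F gT :=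
  flatten [seq [seq (m.1, t) | t <- entry_words m.2 i j] | m <- p].

(** Homogeneous values for the generic entries amount to homogeneous matrices supported in [r]. *)
Lemma entry_poly_TG (R : pzRingType) (sc : F -> R) (hom : gT -> R -> Prop) p :
    (forall g, hom g 0) ->
  (forall Phi : V -> 'I_N -> 'I_N -> R,
     (forall v i j, ~~ r i j -> Phi v i j = 0) ->
     (forall v i j, hom v.1 (Phi v i j)) ->
     forall i j, \sum_(m <- p) sc m.1 * mev Phi m.2 i j = 0) <->
  (forall i j, TG sc hom (entry_poly p i j)).
Proof.
move=> hom0.
have evE (phi : V -> R) (Phi : V -> 'I_N -> 'I_N -> R) i j :
    (forall v i l, Phi v i l = if r i l then phi (entry_var v i l) else 0) ->
    nceval sc phi (entry_poly p i j) = \sum_(m <- p) sc m.1 * mev Phi m.2 i j.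
  move=> e; rewrite /nceval big_flatten big_map; apply: eq_bigr => m _.
  rewrite big_map /= -mulr_sumr; congr (_ * _).
  elim: m.2 i => [|v w IH] i /=.
    by case: eqP => _; rewrite ?big_seq1 ?big_nil.
  rewrite big_flatten big_map big_filter big_mkcond; apply: eq_bigr => l _.
  rewrite e; case: ifP => _; last by rewrite mul0r.
  rewrite big_map -IH mulr_sumr; apply: eq_bigr => t _ /=.
  by rewrite big_cons.
split=> [H i j phi gphi|H Phi sPhi gPhi i j].
  pose Phi v i l := if r i l then phi (entry_var v i l) else 0.
  rewrite (evE _ Phi) //; apply: H => v k l; rewrite /Phi.
    by move/negbTE->.
  by case: ifP => // _; apply: (gphi (entry_var v k l)).
(* Numbers that code no triple are sent to 0, which is homogeneous of every degree. *)
pose phi (v : V) : R :=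
  if unpickle v.2 is Some (k, i, l) then Phi (v.1, k) i l else 0.
rewrite -(evE phi); last first.
  move=> [g k] a l; rewrite /phi /= pickleK /=.
  by case: ifP => // /negbT/sPhi ->.
apply: H => v; rewrite /phi; case: unpickle => [[[k a] l]|//].
exact: (gPhi (v.1, k)).
Qed.

Lemma TG_mxE (R : pzRingType) (sc : F -> R) (hom : gT -> R -> Prop) p :
  TG (R := 'M[R]_N) (fun c => (sc c)%:M)
    (fun g M => (forall i j, ~~ r i j -> M i j = 0) /\ forall i j, hom g (M i j)) p
  <-> (forall Phi : V -> 'I_N -> 'I_N -> R,
     (forall v i j, ~~ r i j -> Phi v i j = 0) ->
     (forall v i j, hom v.1 (Phi v i j)) ->
     forall i j, \sum_(m <- p) sc m.1 * mev Phi m.2 i j = 0).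
Proof.
have E (phi : V -> 'M[R]_N) Phi i j : (forall v i j, phi v i j = Phi v i j) ->
    nceval (fun c => (sc c)%:M) phi p i j =
    \sum_(m <- p) sc m.1 * mev Phi m.2 i j.
  move=> e; rewrite /nceval summxE; apply: eq_bigr => m _.
  rewrite -mulmxE mul_scalar_mx mxE; congr (_ * _).
  elim: m.2 i => [|v w IH] i /=; first by rewrite big_nil mxE.
  by rewrite big_cons mxE; apply: eq_bigr => l _; rewrite e IH.
split=> [H Phi sPhi gPhi i j|H phi gphi].
  pose phi v := \matrix_(i, j) Phi v i j.
  rewrite -(E phi); last by move=> v a b; rewrite mxE.
  rewrite (H phi) ?mxE // => v; split=> a b; rewrite mxE; [exact: sPhi|exact: gPhi].
apply/matrixP => i j; rewrite (E phi (fun v => phi v)) // mxE.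
by apply: H => v a b; [have [+ _] := gphi v; apply|have [_] := gphi v].
Qed.

(** A matrix over ['M[F]_n] is a scalar matrix indexed by pairs, whose degrees come from the inner
    index. *)
Lemma mx_ids_pair n (gs : 'I_n -> gT) p :
  mx_ids (fun x : 'I_N * 'I_n => gs x.2) (fun x y => r x.1 y.1) p <->
  (forall Phi : V -> 'I_N -> 'I_N -> 'M[F]_n,
     (forall v i j, ~~ r i j -> Phi v i j = 0) ->
     (forall v i j, elem_hom gs v.1 (Phi v i j)) ->
     forall i j, \sum_(m <- p) (m.1)%:M * mev Phi m.2 i j = 0).
Proof.
have E (Phi : V -> 'I_N -> 'I_N -> 'M[F]_n) Psi i j a b :
    (forall v i j a b, Psi v (i, a) (j, b) = Phi v i j a b) ->
    (\sum_(m <- p) (m.1)%:M * mev Phi m.2 i j) a b =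
    lin p (fun w => mev Psi w (i, a) (j, b)).
  move=> e; rewrite summxE; apply: eq_bigr => m _.
  rewrite -mulmxE mul_scalar_mx mxE; congr (_ * _).
  elim: m.2 i a => [|v w IH] i a /=.
    by rewrite xpair_eqE; case: (i == j); rewrite ?mxE //= mul0n.
  transitivity (\sum_l \sum_c Psi v (i, a) (l, c) * mev Psi w (l, c) (j, b));
    last by rewrite pair_big; apply: eq_bigr => -[].
  rewrite summxE; apply: eq_bigr => l _; rewrite -mulmxE mxE.
  by apply: eq_bigr => c _; rewrite e IH.
rewrite mx_idsP; split=> [H Phi sPhi gPhi i j|H Psi gPsi [i a] [j b]].
  apply/matrixP => a b; pose Psi v (x y : 'I_N * 'I_n) := Phi v x.1 y.1 x.2 y.2.
  rewrite (E _ Psi) // mxE; apply: H => v [k c] [l d] /= nz; split.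
    by apply/negPn/negP => /sPhi z; move: nz; rewrite /Psi /= z mxE eqxx.
  exact: gPhi nz.
pose Phi v i j := \matrix_(a, b) Psi v (i, a) (j, b).
rewrite -(E Phi Psi); last by move=> *; rewrite mxE.
rewrite H ?mxE //.
  move=> v k l nr; apply/matrixP => c d; rewrite !mxE.
  by apply/eqP/negPn/negP => /gPsi[/= rr]; rewrite rr in nr.
by move=> v k l c d; rewrite mxE => /gPsi[].
Qed.

(** Both sides say that the same entry polynomials are identities, of [A] on one side and of
    ['M[F]_n] on the other. *)
Lemma TG_mx_ids n (gs : 'I_n -> gT) (A : algType F) (Ag : gT -> A -> Prop) p :
    (forall g, Ag g 0) ->
    (forall p, TG_Mn gs p <-> TG (fun c => c%:A) Ag p) ->
  TG (R := 'M[A]_N) (fun c => (c%:A)%:M)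
    (fun g M => (forall i j, ~~ r i j -> M i j = 0) /\ forall i j, Ag g (M i j)) p
  <-> mx_ids (fun x : 'I_N * 'I_n => gs x.2) (fun x y => r x.1 y.1) p.
Proof.
move=> Ag0 TGE; have e0 g : elem_hom gs g (0 : 'M[F]_n).
  by move=> i j; rewrite mxE eqxx.
have EA := @entry_poly_TG A (fun c => c%:A) Ag p Ag0.
have EM := @entry_poly_TG 'M[F]_n (fun c => c%:M) (elem_hom gs) p e0.
apply: iff_trans (@TG_mxE A (fun c => c%:A) Ag p) _.
apply: iff_trans EA _; apply: iff_sym.
apply: iff_trans (mx_ids_pair gs p) _; apply: iff_trans EM _.
by split=> H i j; apply/TGE; apply: H.
Qed.

End Transfer.

(** * G-regularity and the induction on the number of blocks *)

Lemma regular_shift n (gs : 'I_n -> gT) (h : gT) : G_regular gs ->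
  exists f : 'I_n -> 'I_n, bijective f /\ forall i, gs (f i) = (h * gs i)%g.
Proof.
case=> _ cE.
pose fib g := enum [set i | gs i == g].
(* Fibers have equal size, so their elements are matched by position; by [lt] below, the default of
   [nth] is never reached. *)
pose f h i := nth i (fib (h * gs i)%g) (index i (fib (gs i))).
have lt k i : (index i (fib (gs i)) < size (fib (k * gs i)%g))%N.
  by rewrite -cardE (cE _ (gs i)) cardE index_mem mem_enum inE.
have fE k i : gs (f k i) = (k * gs i)%g.
  by apply/eqP; have := mem_nth i (lt k i); rewrite mem_enum inE.
have fK k i : f k^-1%g (f k i) = i.
  rewrite {1}/f fE mulKg {2}/f index_uniq ?enum_uniq //.
  by rewrite nth_index // mem_enum inE.
exists (f h); split=> //; exists (f h^-1%g) => i; first exact: fK.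
by have := fK h^-1%g i; rewrite invgK.
Qed.

Lemma mx_ids_ideal_prod n (gs : 'I_n -> gT) (ds : seq nat) (p : gpoly F gT) :
    abelian [set: gT] -> G_regular gs -> ds != [::] ->
  mx_ids (fun x : 'I_(sumn ds) * 'I_n => gs x.2)
    (fun x y => (blk ds x.1 <= blk ds y.1)%N) p <->
  ideal_prod [seq mx_ids (fun x : 'I_d * 'I_n => gs x.2) (fun _ _ => true)
             | d <- ds] p.
Proof.
move=> abG reg; elim: ds p => [//|d ds IH] p _.
case: (altP (ds =P [::])) => [->|ne].
  (* [sumn [:: d]] is [d + 0], so the indices of a single block need a cast. *)
  have e : (d = d + 0)%N by rewrite addn0.
  apply: iff_sym; apply: (@mx_ids_bij _ _ _ _ _ _ (fun x => (cast_ord e x.1, x.2))).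
  - exists (fun x => (cast_ord (esym e) x.1, x.2)) => -[i a] /=;
    by rewrite ?cast_ordK ?cast_ordKV.
  - by [].
  - by move=> [i a] [j b] /=; rewrite !ltn_ord.
rewrite map_cons ideal_prod_cons ?size_map ?lt0n ?size_eq0 //.
pose M1 := mx_ids (fun x : 'I_d * 'I_n => gs x.2) (fun _ _ => true).
pose M2 := mx_ids (fun x : 'I_(sumn ds) * 'I_n => gs x.2)
    (fun x y => (blk ds x.1 <= blk ds y.1)%N).
apply: (@iff_trans _ (ideal_mul M1 M2 p)); last first.
  split=> -[s [sI sE]]; exists s; split=> // x /sI[h1 h2]; split=> //;
  by apply/IH.
pose d1 (x : 'I_d * 'I_n) := gs x.2.
pose d2 (x : 'I_(sumn ds) * 'I_n) := gs x.2.
pose r1 (x y : 'I_d * 'I_n) := true.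
pose r2 (x y : 'I_(sumn ds) * 'I_n) := (blk ds x.1 <= blk ds y.1)%N.
apply: (@iff_trans _ (mx_ids (block_deg d1 d2) (block_rel r1 r2) p)); last first.
  split; last exact: ideal_mul_block.
  apply: block_ideal_mul => // h.
  have [f [[f' fK f'K] fE]] := regular_shift h reg.
  exists (fun x => (x.1, f x.2)); split=> //.
    by exists (fun x => (x.1, f' x.2)) => -[i a] /=; rewrite ?fK ?f'K.
  by move=> x; apply: fE.
(* On the first [d] rows [blk] is 0, on the others one more than for [ds], so [F1] carries
   [block_rel] to the order of block numbers. *)
pose F1 (x : 'I_d * 'I_n + 'I_(sumn ds) * 'I_n) : 'I_(d + sumn ds) * 'I_n :=
  match x with inl y => (lshift _ y.1, y.2) | inr y => (rshift _ y.1, y.2) end.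
pose F2 (x : 'I_(d + sumn ds) * 'I_n) : 'I_d * 'I_n + 'I_(sumn ds) * 'I_n :=
  match split x.1 with inl i => inl (i, x.2) | inr i => inr (i, x.2) end.
apply: iff_sym; apply: (@mx_ids_bij _ _ _ _ _ _ F1).
- exists F2 => [[[i a]|[i a]]|[i a]]; rewrite /F2 /=.
  + by rewrite (unsplitK (inl i)).
  + by rewrite (unsplitK (inr i)).
  + by case: (split_ordP i) => k ->.
- by move=> [[i a]|[i a]].
- move=> [[i a]|[i a]] [[j b]|[j b]] /=;
  by rewrite ?ltn_ord ?[(d + _ < d)%N]ltnNge ?leq_addr //= ?addKn.
Qed.

End GradedMatrices.

Theorem theorem5p4 (F : fieldType) (gT : finGroupType) (n : nat)
    (gs : 'I_n -> gT) (A : algType F) (Ag : gT -> A -> Prop)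
    (ds : seq nat) :
  [pchar F] =i pred0 ->
  abelian [set: gT] ->
  G_regular gs ->
  is_grading Ag ->
  is_PI A ->
  (forall p, TG_Mn gs p <-> TG (fun c => c%:A) Ag p) ->
  ds != [::] -> all (fun d => 0 < d)%N ds ->
  forall p, TG_UT Ag ds p <-> ideal_prod [seq TG_Md Ag d | d <- ds] p.
Proof.
move=> _ abG reg [Ag0 _ _ _] _ TGE ne _ p.
(* Full matrix algebras are the case where every position is allowed. *)
have MdE d : TG_Md Ag d =
    mx_ids (fun x : 'I_d * 'I_n => gs x.2) (fun _ _ => true).
  apply/funext => q; apply/propext.
  rewrite -(@TG_mx_ids _ _ d (fun _ _ => true) n gs A Ag q Ag0 TGE).
  split=> H phi gphi; apply: H => v; first by have [_ g] := gphi v; exact: g.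
  by split=> // i j; apply: gphi.
rewrite (eq_map MdE) -mx_ids_ideal_prod //.
rewrite -(@TG_mx_ids _ _ _ (fun i j : 'I_(sumn ds) => blk ds i <= blk ds j)%N
  n gs A Ag p Ag0 TGE).
by split=> H phi gphi; apply: H => v; have [z g] := gphi v; split=> // i j;
  move: (z i j); rewrite -ltnNge.
Qed.
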